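(* Let $n\in\{2,3\}$, let $Z\in\mathrm{GL}^+(n,\mathbb{R})$ have polar decomposition $Z=U_pH$ with $U_p\in\mathrm{SO}(n)$ and $H$ real symmetric positive definite, and let $\mu>0$, $\mu_c\ge 0$. Then the minimization problem $$\min_{Q\in\mathrm{SO}(n)}\ \mu\,\|\operatorname{sym}_*\operatorname{Log}(Q^TZ)\|_F^2+\mu_c\,\|\operatorname{skew}_*\operatorname{Log}(Q^TZ)\|_F^2$$ is solved by $Q=U_p$ (with the principal logarithm), and the minimum equals $$\mu\,\|\operatorname{sym}_*\log(U_p^TZ)\|_F^2+\mu_c\,\|\operatorname{skew}_*\log(U_p^TZ)\|_F^2=\mu\,\|\operatorname{sym}_*\log(U_p^TZ)\|_F^2 .$$
   Context: $\mathrm{GL}^+(n,\mathbb{R})$ is the group of real $n\times n$ matrices with positive determinant and $\mathrm{SO}(n)$ the special orthogonal group. $\operatorname{sym}_*X=\frac12(X^*+X)$ and $\operatorname{skew}_*X=\frac12(X-X^* )$ are the Hermitian and skew-Hermitian parts of $X\in\mathbb{C}^{n\times n}$, and $\|X\|_F=\big(\sum_{i,j}|X_{ij}|^2\big)^{1/2}$ is the Frobenius norm. $\operatorname{Log}(M)$ denotes any matrix logarithm of a nonsingular $M$, i.e. any $X\in\mathbb{C}^{n\times n}$ with $\exp X=M$; $\log M$ denotes the principal logarithm (the unique logarithm whose eigenvalues have imaginary part in $(-\pi,\pi)$, defined when $M$ has no eigenvalues in $(-\infty,0]$). The minimum is taken over all $Q\in\mathrm{SO}(n)$ and over all logarithms,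 i.e. over all pairs $(Q,X)$ with $Q\in\mathrm{SO}(n)$, $X\in\mathbb{C}^{n\times n}$, $\exp X=Q^TZ$, of the quantity $\mu\|\operatorname{sym}_*X\|_F^2+\mu_c\|\operatorname{skew}_*X\|_F^2$. *)

(* Defs.v *)
From HB Require Import structures.
From mathcomp Require Import all_boot all_order all_algebra.
From mathcomp Require Import all_classical all_reals all_analysis.
From mathcomp Require Import complex.

Set Implicit Arguments.
Unset Strict Implicit.
Unset Printing Implicit Defensive.

Import Order.TTheory GRing.Theory Num.Theory.
Import numFieldNormedType.Exports.
Local Open Scope classical_set_scope.
Local Open Scope ring_scope.
Local Open Scope sesquilinear_scope.

Definition GLp (R : realType) (n : nat) : set 'M[R]_n := [set Z | 0 < \det Z].

Definition SO (R : realType) (n : nat) : set 'M[R]_n :=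
  [set Q | Q^T *m Q = 1%:M /\ \det Q = 1].

Definition posdef_sym (R : realType) (n : nat) : set 'M[R]_n :=
  [set H | H^T = H /\
           forall v : 'cV[R]_n, v != 0 -> 0 < (v^T *m H *m v) 0 0].

Definition cplx_mx (R : realType) (n : nat) (A : 'M[R]_n) : 'M[R[i]]_n :=
  map_mx (real_complex R) A.

Definition sym_star (R : realType) (n : nat) (X : 'M[R[i]]_n) : 'M[R[i]]_n :=
  2%:R^-1 *: (X^t* + X).

Definition skew_star (R : realType) (n : nat) (X : 'M[R[i]]_n) : 'M[R[i]]_n :=
  2%:R^-1 *: (X - X^t*).

(* [normc] is the modulus with values in R; the generic norm [`|x|] of x : R[i]
   takes its values in R[i]. *)
Definition frobenius (R : realType) (n : nat) (X : 'M[R[i]]_n) : R :=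
  Num.sqrt (\sum_(i < n) \sum_(j < n) ComplexField.Normc.normc (X i j) ^+ 2).

Definition expm (R : realType) (n : nat) (X : 'M[R[i]]_n) : 'M[R[i]]_n :=
  limn (series (fun k : nat => (k`!%:R)^-1 *: X ^+ k)).

Definition is_log (R : realType) (n : nat) (M X : 'M[R[i]]_n) : Prop :=
  expm X = M.

Definition is_principal_log (R : realType) (n : nat) (M X : 'M[R[i]]_n) : Prop :=
  is_log M X /\
  forall a : R[i], eigenvalue X a -> - pi < complex.Im a < pi.

(* 0 when M has no principal logarithm. *)
Definition logm (R : realType) (n : nat) (M : 'M[R[i]]_n) : 'M[R[i]]_n :=
  xget 0 [set X | is_principal_log M X].

Definition log_objective (R : realType) (n : nat) (mu muc : R)
    (X : 'M[R[i]]_n) : R :=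
  mu * frobenius (sym_star X) ^+ 2 + muc * frobenius (skew_star X) ^+ 2.

(* [Log] is multivalued: a candidate is a rotation Q together with any one of
   the complex logarithms of Q^T Z. *)
Definition log_candidates (R : realType) (n : nat) (Z : 'M[R]_n) :
    set ('M[R]_n * 'M[R[i]]_n) :=
  [set p | SO p.1 /\ is_log (cplx_mx (p.1^T *m Z)) p.2].

Definition is_minimizer (R : realType) (T : Type) (f : T -> R) (A : set T)
    (x : T) : Prop :=
  A x /\ forall y, A y -> f x <= f y.

Definition is_minimum (R : realType) (A : set R) (m : R) : Prop :=
  A m /\ lbound A m.

(* Main.v *)
Require Import Defs.
From HB Require Import structures.
From mathcomp Require Import all_boot all_order all_algebra.
From mathcomp Require Import all_classical all_reals all_analysis.
From mathcomp Require Import complex.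
From mathcomp Require Import ring lra.

Set Implicit Arguments.
Unset Strict Implicit.
Unset Printing Implicit Defensive.
Import Order.TTheory GRing.Theory Num.Theory.
Import numFieldNormedType.Exports.
Local Open Scope classical_set_scope.
Local Open Scope ring_scope.

(* Let A = exp X with exp X = Q^T Z, so that A^* A = H^2, and let s be the
   eigenvalues of S = sym_* X, l those of log H.  The solution y(t) = exp(tX) v of
   y' = X y satisfies d|y|^2/dt = 2 <y, S y>, so |A v|^2 lies between
   e^(2 min s) |v|^2 and e^(2 max s) |v|^2; for eigenvectors v of H this puts
   every l_i between min s and max s.  Also |det A| = e^(Re tr X) gives
   sum l = sum s.  In dimension 2 or 3 these facts say that l is majorized by s,
   whence |log H|_F^2 = sum l^2 <= sum s^2 = |sym_* X|_F^2, while the skew part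
   contributes a nonnegative amount, which is 0 for X = log H.

   The value of [logm] at H requires uniqueness of the principal logarithm: any
   logarithm of a diagonalizable matrix is diagonalizable, and an eigenvector of
   it is one of H, whose eigenvalue determines that of the logarithm in the
   strip |Im| < pi.

   Entries of exp(tX) are handled as sums of c_k t^k / k! with c_k an entry of
   X^k; this is linear in the sequence c, and differentiation in t is the shift
   of c, so no product formula for exponentials is needed. *)

(** * Exponential generating functions *)

Section ExponentialGeneratingFunctions.
Local Open Scope complex_scope.
Local Notation Re := (@complex.Re _).
Local Notation Im := (@complex.Im _).
Variable R : realType.
Implicit Types (a : nat -> R) (c : nat -> R[i]).

Definition egf a (t : R) : R := limn (pseries (fun k => a k / k`!%:R) t).

(** Domination by [|K|] times the exponential series at [|r| * |t|]; the absolute values allow for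
    either sign of [K], [r] and [t]. *)
Lemma is_cvg_egf a (K r t : R) : (forall k, `|a k| <= K * r ^+ k) ->
  cvgn (pseries (fun k => a k / k`!%:R) t).
Proof.
move=> aKr; apply: normed_cvg.
apply: (@series_le_cvg _ _ (`|K| *: exp_coeff (`|r| * `|t|))).
- by move=> k /=.
- by move=> k; rewrite mulr_ge0// exp_coeff_ge0// mulr_ge0.
- move=> k; rewrite /= !normrM normfV normr_nat normrX.
  rewrite [leRHS](_ : _ = (`|K| * `|r| ^+ k) / k`!%:R * `|t| ^+ k); last first.
    by rewrite /GRing.scale /= /GRing.scale /= /exp_coeff /= exprMn; ring.
  rewrite !ler_wpM2r ?invr_ge0// ?exprn_ge0//.
  by rewrite (le_trans (aKr k))// -normrX -normrM ler_norm.
- by apply: is_cvg_seriesZ; exact: is_cvg_series_exp_coeff.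
Qed.

Lemma is_derive_egf a (K r t : R) : (forall k, `|a k| <= K * r ^+ k) ->
  is_derive t 1 (egf a) (egf (fun k => a k.+1) t).
Proof.
move=> aKr; have diffsE (b : nat -> R) : pseries_diffs (fun k => b k / k`!%:R) =
    fun k => b k.+1 / k`!%:R.
  apply/funext => k; rewrite /pseries_diffs factS natrM invfM.
  by rewrite mulrCA mulrA -[LHS]mulrA mulVKf.
have shift (b : nat -> R) L : (forall k, `|b k| <= L * r ^+ k) ->
    forall k, `|b k.+1| <= L * r * r ^+ k.
  by move=> bL k; rewrite -mulrA -exprS.
rewrite /egf -(diffsE a).
(* Termwise differentiation asks for convergence of the series and of its first two formal
   derivatives at a point of modulus larger than [|t|]. *)
apply: (@pseries_snd_diffs _ _ (`|t| + 1)); rewrite ?diffsE.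
- exact: is_cvg_egf aKr.
- exact: is_cvg_egf (shift _ _ aKr).
- exact: is_cvg_egf (shift _ _ (shift _ _ aKr)).
- by rewrite [ltRHS]ger0_norm// ltrDl.
Qed.

Lemma egf0 a : egf a 0 = a 0%N.
Proof.
(* At 0 the partial sums are constant from index 1 on, since [0 ^+ 0 = 1]; the empty sum at index 0
   is skipped. *)
apply: lim_near_cst => //; exists 1%N => // -[//|n] _.
rewrite /pseries /series /= big_nat_recl//= fact0 divr1 expr0 mulr1.
by rewrite big1 ?addr0// => i _; rewrite expr0n mulr0.
Qed.

Lemma cvg_complex (u : nat -> R[i]^o) (z : R[i]^o) :
  Re (u n) @[n --> \oo] --> Re z -> Im (u n) @[n --> \oo] --> Im z ->
  u n @[n --> \oo] --> z.
Proof.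
move=> /cvgrPdist_lt uRe /cvgrPdist_lt uIm; apply/cvgrPdist_lt => e.
(* A positive element of [R[i]] has zero imaginary part, so the radius is a real number. *)
case: e => e e'; rewrite ltcE/= => /andP[/eqP -> e0].
have e20 : 0 < e / 2 by rewrite divr_gt0.
near=> n.
have Hre : `|Re z - Re (u n)| < e / 2 by near: n; exact: uRe.
have Him : `|Im z - Im (u n)| < e / 2 by near: n; exact: uIm.
rewrite [z - u n]complexE (le_lt_trans (ler_normD _ _))//.
rewrite normrM [`|'i|](_ : _ = 1) ?mul1r; last first.
  by rewrite normc_def/= expr0n expr1n add0r sqrtr1.
rewrite !normc_def/= expr0n !addr0 !sqrtr_sqr -rmorphD/= ltcR.
move: Hre Him; case: (z) (u n) => zr zi [ur ui] /=; lra.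
Unshelve. all: by end_near. Qed.

Definition exp_bounded c := exists K r : R, forall k, `|c k| <= (K * r ^+ k)%:C.

Lemma exp_bounded_Re_Im c : exp_bounded c -> exists K r : R,
  (forall k, `|Re (c k)| <= K * r ^+ k) /\ (forall k, `|Im (c k)| <= K * r ^+ k).
Proof.
move=> [K [r cKr]]; exists K, r; split=> k; rewrite -lecR;
  apply: le_trans (cKr k); first exact: normc_ge_Re.
rewrite -[Im _]opprK normrN -ReiNIm (le_trans (normc_ge_Re _))// normrM.
by rewrite [`|'i|](_ : _ = 1) ?mulr1// normc_def/= expr0n expr1n add0r sqrtr1.
Qed.

(** Built from real and imaginary parts so that real differentiation applies; [egfcP] identifies it
    with the complex series. *)
Definition egfc c (t : R) : R[i] :=
  egf (fun k => Re (c k)) t +i* egf (fun k => Im (c k)) t.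

(** The summand has the shape of the one in [expm]. As a relation, it lets two evaluations of one
    series be compared by uniqueness of limits. *)
Definition cvg_egfc c (t : R) (z : R[i]) : Prop :=
  series (fun k => (k`!%:R)^-1 * (c k * (t ^+ k)%:C) : R[i]^o) @ \oo --> (z : R[i]^o).

Lemma egfcP c t : exp_bounded c -> cvg_egfc c t (egfc c t).
Proof.
move=> /exp_bounded_Re_Im[K [r [cRe cIm]]].
have termE k : (k`!%:R)^-1 * (c k * (t ^+ k)%:C) =
    (Re (c k) / k`!%:R * t ^+ k) +i* (Im (c k) / k`!%:R * t ^+ k).
  rewrite (_ : (k`!%:R)^-1 = (k`!%:R^-1)%:C); last by rewrite fmorphV rmorph_nat.
  by case: (c k) => x y; apply/eqP; rewrite eq_complex /=; apply/andP; split;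
    apply/eqP; ring.
apply: cvg_complex.
- rewrite (_ : (fun n => _) = pseries (fun k => Re (c k) / k`!%:R) t).
    exact: is_cvg_egf cRe.
  apply/funext => n; rewrite /pseries /series /= raddf_sum.
  by apply: eq_bigr => k _; rewrite termE.
- rewrite (_ : (fun n => _) = pseries (fun k => Im (c k) / k`!%:R) t).
    exact: is_cvg_egf cIm.
  apply/funext => n; rewrite /pseries /series /= raddf_sum.
  by apply: eq_bigr => k _; rewrite termE.
Qed.

Lemma cvg_egfc_unique c t z z' : cvg_egfc c t z -> cvg_egfc c t z' -> z = z'.
Proof. by move=> cz cz'; apply: cvg_unique cz cz'. Qed.

Lemma cvg_egfc_sum (I : finType) (l : I -> R[i]) (c : I -> nat -> R[i]) t z :
  (forall i, cvg_egfc (c i) t (z i)) ->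
  cvg_egfc (fun k => \sum_i l i * c i k) t (\sum_i l i * z i).
Proof.
move=> cz; rewrite /cvg_egfc (_ : series _ = fun n => \sum_i (l i *
    series (fun k => (k`!%:R)^-1 * (c i k * (t ^+ k)%:C) : R[i]^o) n)).
  by apply: cvg_big => [|i _]; [exact: add_continuous|apply: cvgMl_tmp; exact: cz].
apply/funext => n; rewrite /series /=.
under [RHS]eq_bigr do rewrite mulr_sumr.
rewrite exchange_big /=; apply: eq_bigr => k _.
by rewrite mulr_suml mulr_sumr; apply: eq_bigr => i _; ring.
Qed.

Lemma exp_bounded_sum (I : finType) (l : I -> R[i]) (c : I -> nat -> R[i]) :
  (forall i, exp_bounded (c i)) -> exp_bounded (fun k => \sum_i l i * c i k).
Proof.
move=> /choice[K /choice[r cKr]].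
(* One rate has to serve all indices: the sum of the [|r i|] dominates each of them. [Re] brings the
   moduli, real elements of [R[i]], into [R]. *)
exists (\sum_i Re `|l i| * `|K i|), (\sum_i `|r i|) => k.
rewrite (le_trans (ler_norm_sum _ _ _))// mulr_suml rmorph_sum ler_sum// => i _.
rewrite normrM -mulrA [leRHS](rmorphM (real_complex R)).
rewrite [X in _ <= X * _](RRe_real (normr_real _)) ler_wpM2l//.
rewrite (le_trans (cKr i k))// lecR (le_trans (ler_norm _))// normrM normrX.
rewrite ler_wpM2l// lerXn2r ?nnegrE// ?sumr_ge0//.
by rewrite (bigD1 i)//= lerDl sumr_ge0.
Qed.

Lemma egfc_sum (I : finType) (l : I -> R[i]) (c : I -> nat -> R[i]) t :
  (forall i, exp_bounded (c i)) ->
  egfc (fun k => \sum_i l i * c i k) t = \sum_i l i * egfc (c i) t.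
Proof.
move=> cb; apply: (@cvg_egfc_unique (fun k => \sum_i l i * c i k) t).
  by apply: egfcP; exact: exp_bounded_sum.
by apply: cvg_egfc_sum => i; exact: egfcP.
Qed.

Lemma egfcZ (l : R[i]) c t : exp_bounded c ->
  egfc (fun k => l * c k) t = l * egfc c t.
Proof.
move=> cb; have := @egfc_sum unit (fun=> l) (fun=> c) t (fun=> cb).
rewrite big_const card_unit /= addr0 => <-; congr egfc.
by apply/funext => k; rewrite big_const card_unit /= addr0.
Qed.

Lemma exp_bounded_expr (z : R[i]) : exp_bounded (fun k => z ^+ k).
Proof.
exists 1, (Re `|z|) => k.
rewrite mul1r normrX [leRHS](rmorphXn (real_complex R)).
by rewrite [X in _ <= X ^+ _](RRe_real (normr_real _)).
Qed.

Lemma egfc_cst0 t : egfc (fun=> 0) t = 0.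
Proof.
rewrite -[RHS](mul0r (egfc (fun k => 0 ^+ k) t)) -egfcZ; last exact: exp_bounded_expr.
by congr egfc; apply/funext => k; rewrite mul0r.
Qed.

Lemma egfc_at0 c : egfc c 0 = c 0%N.
Proof. by rewrite /egfc !egf0; case: (c 0%N). Qed.

Lemma is_derive_egfc c (t : R) : exp_bounded c ->
  is_derive t 1 (fun t => Re (egfc c t))
    (Re (egfc (fun k => c k.+1) t)) /\
  is_derive t 1 (fun t => Im (egfc c t))
    (Im (egfc (fun k => c k.+1) t)).
Proof.
move=> /exp_bounded_Re_Im[K [r [cRe cIm]]].
by split; [exact: is_derive_egf cRe|exact: is_derive_egf cIm].
Qed.

End ExponentialGeneratingFunctions.

(** * Complex and matrix exponentials *)

Section ComplexExponential.
Local Open Scope complex_scope.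
Local Notation Re := (@complex.Re _).
Local Notation Im := (@complex.Im _).
Variable R : realType.

Lemma rotation_ode (U V : R -> R) (x y : R) :
  (forall t : R, is_derive t (1 : R) U (x * U t - y * V t)) ->
  (forall t : R, is_derive t (1 : R) V (x * V t + y * U t)) ->
  U 0 = 1 -> V 0 = 0 -> U 1 = expR x * cos y /\ V 1 = expR x * sin y.
Proof.
move=> dU dV U0 V0.
(* [f + i g] is [(U + i V) e^(-(x + i y) t)], hence constant. *)
pose f t := expR (- x * t) * (U t * cos (y * t) + V t * sin (y * t)).
pose g t := expR (- x * t) * (V t * cos (y * t) - U t * sin (y * t)).
have f1 : f 1 = 1.
  rewrite (_ : 1 = f 0) ?[f 0 in RHS]/f; last first.
    by rewrite /f !mulr0 expR0 cos0 sin0 U0 V0; ring.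
  apply: is_derive_0_is_cst => t; rewrite /f.
  by apply: trigger_derive; rewrite /GRing.scale /=; ring.
have g1 : g 1 = 0.
  rewrite (_ : 0 = g 0) ?[g 0 in RHS]/g; last first.
    by rewrite /g !mulr0 expR0 cos0 sin0 U0 V0; ring.
  apply: is_derive_0_is_cst => t; rewrite /g.
  by apply: trigger_derive; rewrite /GRing.scale /=; ring.
have {}f1 : U 1 * cos y + V 1 * sin y = expR x.
  move: f1; rewrite /f !mulr1 => f1.
  by rewrite -[RHS]mulr1 -[X in _ = _ * X]f1 mulrA -expRD subrr expR0 mul1r.
have {}g1 : V 1 * cos y - U 1 * sin y = 0.
  by move/eqP: g1; rewrite /g !mulr1 mulf_eq0 expR_eq0 => /eqP.
(* Rotation by [- y] takes [(U 1, V 1)] to [(expR x, 0)]; rotating back by [y] gives both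
   coordinates. *)
rewrite -f1; have cs := cos2Dsin2 y; split.
- transitivity (U 1 * (cos y ^+ 2 + sin y ^+ 2)
    + sin y * (V 1 * cos y - U 1 * sin y)); last by ring.
  by rewrite cs g1; ring.
- transitivity (V 1 * (cos y ^+ 2 + sin y ^+ 2)
    - cos y * (V 1 * cos y - U 1 * sin y)); last by ring.
  by rewrite cs g1; ring.
Qed.

Definition cexp (z : R[i]) : R[i] := egfc (fun k => z ^+ k) 1.

(** The shift of the sequence of powers of [z] is its multiple by [z], so the generating function
    solves [w' = z w], [w(0) = 1], which is [rotation_ode] in real coordinates. *)
Lemma cexpE (z : R[i]) :
  cexp z = (expR (Re z) * cos (Im z)) +i* (expR (Re z) * sin (Im z)).
Proof.
pose U t := Re (egfc (fun k => z ^+ k) t).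
pose V t := Im (egfc (fun k => z ^+ k) t).
have dE t : egfc (fun k => z ^+ k.+1) t = z * egfc (fun k => z ^+ k) t.
  rewrite -egfcZ; last exact: exp_bounded_expr.
  by congr egfc; apply/funext => k; rewrite exprS.
have [] := @rotation_ode U V (Re z) (Im z).
- move=> t; have [+ _] := is_derive_egfc t (exp_bounded_expr z).
  by rewrite dE /U /V; case: (z) (egfc _ _) => [? ?] [? ?].
- move=> t; have [_ +] := is_derive_egfc t (exp_bounded_expr z).
  by rewrite dE /U /V; case: (z) (egfc _ _) => [? ?] [? ?].
- by rewrite /U egfc_at0.
- by rewrite /V egfc_at0.
by rewrite /U /V /cexp => <- <-; case: (egfc _ _).
Qed.

Lemma cexp_real (x : R) : cexp x%:C = (expR x)%:C.
Proof. by rewrite cexpE /= cos0 sin0 mulr1 mulr0. Qed.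

Lemma normc_cexp (z : R[i]) : `|cexp z| = (expR (Re z))%:C.
Proof.
rewrite cexpE normc_def /= !exprMn -mulrDr cos2Dsin2 mulr1 sqrtr_sqr.
by rewrite ger0_norm ?expR_ge0.
Qed.

(** The modulus determines the real part; then the cosine of the imaginary part is 1, and
    injectivity of [cos] on [[0, pi]] leaves only 0 in the strip. *)
Lemma cexp_inj_ln (z : R[i]) (d : R) : - pi < Im z < pi -> 0 < d ->
  cexp z = d%:C -> z = (ln d)%:C.
Proof.
move=> zpi d0 zd.
have Rez : expR (Re z) = d.
  by apply: (@complexI R); rewrite -normc_cexp zd ger0_norm// lecR ltW.
move: zd; rewrite cexpE Rez => -[/(canRL (mulKf (lt0r_neq0 d0))) cosz].
rewrite mulVf ?lt0r_neq0// in cosz => _.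
suff Imz : Im z = 0 by rewrite [z]complexE Imz -Rez expRK mulr0 addr0.
case/andP: zpi => zpi1 zpi2.
have /orP[Imz|Imz] := le_total 0 (Im z).
- by apply: cos_inj; rewrite ?in_itv/= ?lexx ?pi_ge0 ?cos0// Imz ltW.
- apply/oppr_inj; rewrite oppr0.
  apply: cos_inj; rewrite ?in_itv/= ?lexx ?pi_ge0 ?cosN ?cos0//.
  by rewrite oppr_ge0 Imz lerNl ltW.
Qed.

End ComplexExponential.

Section MatrixExponential.
Local Open Scope complex_scope.
Local Notation Re := (@complex.Re _).
Local Notation Im := (@complex.Im _).
Variable R : realType.
Local Notation C := R[i].

Lemma exp_bounded_expmx n (X : 'M[C]_n) i j : exp_bounded (fun k => (X ^+ k) i j).
Proof.
(* The sum of all entry moduli dominates every row sum, which is what the induction on the exponent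
   uses. *)
pose r := \sum_a \sum_b `|X a b|.
have rr : r \is Num.real.
  by apply: ger0_real; rewrite !sumr_ge0// => ? _; rewrite sumr_ge0.
exists 1, (Re r) => k; rewrite mul1r [leRHS](rmorphXn (real_complex R)).
rewrite [X in _ <= X ^+ _](RRe_real rr).
elim: k i j => [|k IHk] i j.
  by rewrite !expr0 mxE; case: eqP; rewrite ?normr1 ?normr0.
rewrite !exprS mxE (le_trans (ler_norm_sum _ _ _))//.
rewrite (@le_trans _ _ (\sum_l `|X i l| * r ^+ k))//.
  by apply: ler_sum => l _; rewrite normrM ler_wpM2l.
rewrite -mulr_suml ler_wpM2r ?exprn_ge0//.
  by rewrite sumr_ge0// => ? _; rewrite sumr_ge0.
by rewrite /r [leRHS](bigD1 i)//= lerDl sumr_ge0// => ? _; rewrite sumr_ge0.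
Qed.

Lemma expmE n (X : 'M[C]_n) i j : expm X i j = egfc (fun k => (X ^+ k) i j) 1.
Proof.
pose M := \matrix_(i, j) egfc (fun k => (X ^+ k) i j) 1.
suff : expm X = M by move->; rewrite mxE.
have entry_cvg a b : (fun m => series (fun k => (k`!%:R)^-1 *: X ^+ k) m a b : C^o)
    @ \oo --> (M a b : C^o).
  rewrite mxE (_ : (fun m => _) =
      series (fun k => (k`!%:R)^-1 * ((X ^+ k) a b * (1 ^+ k)%:C) : C^o)).
    by apply: egfcP; exact: exp_bounded_expmx.
  apply/funext => m; rewrite /series /= summxE; apply: eq_bigr => k _.
  by rewrite mxE expr1n mulr1.
have cvgM : series (fun k => (k`!%:R)^-1 *: X ^+ k) @ \oo -->
    (M : ('M[C]_n : normedModType C)).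
  (* A neighbourhood of [M] contains a product of neighbourhoods of its finitely many entries, so
     entrywise convergence suffices. *)
  move=> A [P MP PA].
  have : \forall m \near \oo, forall a b,
      P a b (series (fun k => (k`!%:R)^-1 *: X ^+ k) m a b).
    apply: filter_forall => a; apply: filter_forall => b.
    exact: (entry_cvg a b _ (MP a b)).
  by apply: filterS => m; exact: PA.
exact: (cvg_lim (@norm_hausdorff _ _) cvgM).
Qed.

(** A linear combination of entries of [M] over a single finite index type is the form that
    [egfc_sum] handles. *)
Lemma mulmx3E n p q (A : 'M[C]_(p, n)) (M : 'M[C]_n) (B : 'M[C]_(n, q)) i j :
  (A *m M *m B) i j =
  \sum_(ab : 'I_n * 'I_n) (A i ab.1 * B ab.2 j) * M ab.1 ab.2.
Proof.
rewrite -(pair_bigA _ (fun a b => (A i a * B b j) * M a b)) exchange_big /= mxE.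
by apply: eq_bigr => b _; rewrite mxE mulr_suml; apply: eq_bigr => a _; ring.
Qed.

Lemma exp_bounded_mulmx n p q (A : 'M[C]_(p, n)) (X : 'M[C]_n) (B : 'M[C]_(n, q))
  i j : exp_bounded (fun k => (A *m X ^+ k *m B) i j).
Proof.
under eq_fun do rewrite mulmx3E.
by apply: exp_bounded_sum => -[a b]; exact: exp_bounded_expmx.
Qed.

Lemma mulmx_expmE n p q (A : 'M[C]_(p, n)) (X : 'M[C]_n) (B : 'M[C]_(n, q)) i j :
  (A *m expm X *m B) i j = egfc (fun k => (A *m X ^+ k *m B) i j) 1.
Proof.
rewrite mulmx3E; under [in RHS]eq_fun do rewrite mulmx3E.
rewrite egfc_sum => [|[a b]]; last exact: exp_bounded_expmx.
by apply: eq_bigr => -[a b] _; rewrite expmE.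
Qed.

Lemma expm_conj n (P X : 'M[C]_n) : P \in unitmx ->
  expm (invmx P *m X *m P) = invmx P *m expm X *m P.
Proof.
move=> Pu; apply/matrixP => i j; rewrite mulmx_expmE expmE.
congr egfc; apply/funext => k; congr (fun_of_matrix _ i j).
elim: k => [|k IHk]; first by rewrite !expr0 mulmx1 mulVmx.
by rewrite !exprS IHk -!mulmxE !mulmxA mulmxK.
Qed.

Lemma expm_diag n (d : 'rV[C]_n) : expm (diag_mx d) = diag_mx (map_mx (@cexp R) d).
Proof.
apply/matrixP => i j; rewrite expmE !mxE.
have powE k : (diag_mx d ^+ k) i j = (d 0 i ^+ k) *+ (i == j).
  elim: k j => [|k IHk] j; first by rewrite !expr0 mxE.
  rewrite exprSr mxE (bigD1 j)//= big1 ?addr0 => [|l lj].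
    rewrite IHk mxE eqxx mulr1n exprSr; case: eqP => [->//|_].
    by rewrite !mulr0n mul0r.
  by rewrite [X in _ * X]mxE (negbTE lj) mulr0n mulr0.
under eq_fun do rewrite powE.
by case: eqP => // _; rewrite mulr0n egfc_cst0.
Qed.

Lemma trig_expmx n (X : 'M[C]_n) k : is_trig_mx X ->
  (forall i j : 'I_n, (i < j)%N -> (X ^+ k) i j = 0) /\
  (forall i, (X ^+ k) i i = X i i ^+ k).
Proof.
move=> /is_trig_mxP Xt; elim: k => [|k [IH0 IH1]].
  split=> [i j ij|i]; rewrite expr0 mxE ?eqxx//.
  by rewrite -val_eqE (ltn_eqF ij).
split=> [i j ij|i]; rewrite exprS mxE.
- apply: big1 => l _; have [il|li] := ltnP i l; first by rewrite Xt// mul0r.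
  by rewrite IH0 ?mulr0// (leq_ltn_trans li).
- rewrite (bigD1 i)//= IH1 big1 ?addr0 ?exprS// => l li.
  have [il|] := ltnP i l; first by rewrite Xt// mul0r.
  by rewrite leq_eqVlt val_eqE (negbTE li)/= => /IH0 ->; rewrite mulr0.
Qed.

Lemma det_expm_trig n (X : 'M[C]_n) : is_trig_mx X ->
  \det (expm X) = \prod_i cexp (X i i).
Proof.
move=> Xt; rewrite det_trig; last first.
  apply/is_trig_mxP => i j ij; rewrite expmE.
  by under eq_fun do rewrite (proj1 (trig_expmx _ Xt))//; rewrite egfc_cst0.
apply: eq_bigr => i _; rewrite expmE /cexp.
by under eq_fun do rewrite (proj2 (trig_expmx _ Xt)).
Qed.

(** Determinant and trace are invariant under conjugation, so Schur triangularization reduces the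
    claim to the diagonal entries, where it is [normc_cexp]. *)
Lemma normc_det_expm n (X : 'M[C]_n) : `|\det (expm X)| = (expR (Re (\tr X)))%:C.
Proof.
(* [Schur] asks for positive size; in size 0 the determinant is 1 and the trace 0. *)
case: n X => [X|n X].
  by rewrite det_mx00 /mxtrace big_ord0 /= expR0 normr1.
have [P /unitarymx_unit Pu] := Schur X (ltn0Sn n).
rewrite /similar_to /= conjumx// => Tt; set T := (X in is_trig_mx X) in Tt.
have XE : X = invmx P *m T *m P by rewrite /T !mulmxA mulVmx// mul1mx mulmxKV.
rewrite XE expm_conj// !det_mulmx mxtrace_mulC mulmxA mulmxV// mul1mx.
rewrite mulrAC -det_mulmx mulVmx// det1 mul1r det_expm_trig// normr_prod.
rewrite /mxtrace raddf_sum expR_sum rmorph_prod; apply: eq_bigr => i _.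
exact: normc_cexp.
Qed.

(** Along a Jordan chain [v X^k = a^k v + k a^(k-1) w], and the series of [k a^(k-1) / k!] is again
    that of [cexp a]. Taking [w = 0] gives the case of an eigenvector. *)
Lemma expm_jordan n (X : 'M[C]_n) (a : C) (v w : 'rV[C]_n) :
  v *m X = a *: v + w -> w *m X = a *: w -> v *m expm X = cexp a *: (v + w).
Proof.
move=> vX wX; apply/rowP => j.
have wXk k : w *m X ^+ k = a ^+ k *: w.
  elim: k => [|k IHk]; first by rewrite !expr0 mulmx1 scale1r.
  by rewrite exprSr -mulmxE mulmxA IHk -scalemxAl wX scalerA exprSr.
have vXk k : v *m X ^+ k = a ^+ k *: v + (k%:R * a ^+ k.-1) *: w.
  elim: k => [|k IHk]; first by rewrite !expr0 mulmx1 scale1r mul0r scale0r addr0.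
  rewrite exprSr -mulmxE mulmxA IHk mulmxDl -!scalemxAl vX wX scalerDr !scalerA.
  rewrite -addrA -scalerDl exprSr; congr (_ + _ *: _).
  by case: k {IHk} => [|k] /=; rewrite ?expr0 -?natr1 ?exprSr; ring.
have da : cvg_egfc (fun k => k%:R * a ^+ k.-1) 1 (cexp a).
  (* The term at index 0 vanishes through its factor [k%:R]; dropping it turns [k / k!] into
     [1 / (k-1)!]. *)
  rewrite /cvg_egfc -cvg_shiftS; rewrite (_ : (fun m => _) =
      series (fun k => (k`!%:R)^-1 * (a ^+ k * (1 ^+ k)%:C) : C^o)).
    by apply: egfcP; exact: exp_bounded_expr.
  apply/funext => m; rewrite /series /= big_nat_recl//= !mul0r mulr0 add0r.
  apply: eq_bigr => k _; rewrite !expr1n factS natrM invfM !mulr1 mulrACA.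
  by rewrite mulVf ?pnatr_eq0// mul1r.
have ca : cvg_egfc (fun k => a ^+ k) 1 (cexp a) by apply: egfcP; exact: exp_bounded_expr.
have := @cvg_egfc_sum R bool (fun b => if b then v 0 j else w 0 j)
  (fun b k => if b then a ^+ k else k%:R * a ^+ k.-1) 1 (fun=> cexp a).
move=> /(_ _)/cvg_egfc_unique H.
have -> : (cexp a *: (v + w)) 0 j = v 0 j * cexp a + w 0 j * cexp a.
  by rewrite !mxE; ring.
rewrite -[v *m _]mulmx1 mulmx_expmE.
apply/esym; rewrite big_bool in H; apply: H; first by case.
rewrite (_ : (fun k => \sum_(b : bool) _) =
    fun k => (v *m X ^+ k *m 1%:M) 0 j).
  by apply: egfcP; exact: exp_bounded_mulmx.
by apply/funext => k; rewrite big_bool mulmx1 vXk !mxE /=; ring.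
Qed.

End MatrixExponential.

(** * The principal logarithm of a diagonalizable matrix *)

Section PrincipalLogarithm.
Local Open Scope complex_scope.
Local Notation Re := (@complex.Re _).
Local Notation Im := (@complex.Im _).
Variable R : realType.
Local Notation C := R[i].

(** Starting from Cayley-Hamilton, the hypothesis removes repeated linear factors one at a time,
    until a polynomial with simple roots annihilates [X]. *)
Lemma diagonalizable_semisimple n (X : 'M[C]_n.+1) :
  (forall a (v : 'rV_n.+1),
    v *m (X - a%:M) *m (X - a%:M) = 0 -> v *m (X - a%:M) = 0) ->
  diagonalizable X.
Proof.
move=> ssX; apply/diagonalizableP.
have [s sX] := closed_field_poly_normal (char_poly X).
exists (undup s); first exact: undup_uniq.
apply: mxminpoly_min.
(* The cofactor [p] is general so that the induction on [t] can move the factors already passed into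
   it. *)
suff killed t p : horner_mx X (p * \prod_(x <- t) ('X - x%:P)) = 0 ->
    horner_mx X (p * \prod_(x <- undup t) ('X - x%:P)) = 0.
  rewrite -[\prod_(x <- undup s) _]mul1r; apply: killed.
  have := Cayley_Hamilton X; rewrite sX.
  by rewrite (monicP (char_poly_monic X)) scale1r mul1r.
have ssM (M : 'M[C]_n.+1) (a : C) :
    M *m (X - a%:M) *m (X - a%:M) = 0 -> M *m (X - a%:M) = 0.
  move=> M0; apply/row_matrixP => i; rewrite row_mul row0; apply: ssX.
  by rewrite -!row_mul M0 row0.
have hornerM (r : {poly C}) (a : C) :
    horner_mx X (r * ('X - a%:P)) = horner_mx X r *m (X - a%:M).
  by rewrite rmorphM rmorphB /= horner_mx_X horner_mx_C.
elim: t p => [//|a t IHt] p; rewrite big_cons mulrA => /IHt /=.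
case: ifP => [at_|_]; last by rewrite big_cons mulrA.
have /perm_to_rem tE : a \in undup t by rewrite mem_undup.
rewrite (perm_big _ tE) big_cons /=.
set q := \prod_(_ <- _) _.
have -> : p * ('X - a%:P) * (('X - a%:P) * q) =
  p * q * ('X - a%:P) * ('X - a%:P) by ring.
have -> : p * (('X - a%:P) * q) = p * q * ('X - a%:P) by ring.
by rewrite !hornerM => /ssM.
Qed.

Lemma cexp_neq0 (z : C) : cexp z != 0.
Proof. by rewrite -normr_eq0 normc_cexp fmorph_eq0 expR_eq0. Qed.

(* By [expm_jordan], a Jordan block of [X] at [a] gives one of [expm X] at
   [cexp a], which is nonzero. *)
Lemma diagonalizable_expm n (X P : 'M[C]_n.+1) (d : 'rV[C]_n.+1) :
  P \in unitmx -> expm X = invmx P *m diag_mx d *m P -> diagonalizable X.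
Proof.
move=> Pu XE; apply: diagonalizable_semisimple => a v; set w := v *m (X - _).
move=> wX0.
have vX : v *m X = a *: v + w.
  by rewrite /w mulmxBr mul_mx_scalar addrC subrK.
have wX : w *m X = a *: w.
  by apply/eqP; rewrite -subr_eq0 -mul_mx_scalar -mulmxBr wX0.
(* In coordinates relative to the rows of [P], [expm X] multiplies the coordinate [i] by [d 0 i]. *)
have spec (u z : 'rV[C]_n.+1) : u *m expm X = cexp a *: z ->
    forall i, (u *m invmx P) 0 i * d 0 i = cexp a * (z *m invmx P) 0 i.
  move=> uX i; have : u *m invmx P *m diag_mx d = cexp a *: (z *m invmx P).
    by rewrite scalemxAl -uX XE !mulmxA mulmxK.
  by move/matrixP/(_ 0 i); rewrite mul_mx_diag mxE => ->; rewrite mxE.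
have vP := spec _ _ (expm_jordan vX wX).
have wP : forall i, (w *m invmx P) 0 i * d 0 i = cexp a * (w *m invmx P) 0 i.
  by apply: spec; rewrite (expm_jordan (a := a) (w := 0)) ?addr0// mul0mx scaler0.
rewrite -[w](mulmxKV Pu) (_ : w *m invmx P = 0) ?mul0mx//.
apply/rowP => i; rewrite [RHS]mxE; apply/eqP; apply: contraT => wi0.
(* A nonzero coordinate of [w] fixes [d 0 i] as [cexp a]; the equation for [v] then makes [cexp a]
   times that coordinate vanish. *)
have di : d 0 i = cexp a by apply: (mulfI wi0); rewrite wP mulrC.
move: (vP i); rewrite di mulmxDl [X in _ = _ * X]mxE mulrDr mulrC => /eqP.
rewrite -subr_eq0 opprD addrA subrr add0r oppr_eq0 mulf_eq0.
by rewrite (negbTE (cexp_neq0 a)) (negbTE wi0).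
Qed.

Lemma is_principal_log_diag n (P : 'M[C]_n) (l : 'rV[R]_n) : P \in unitmx ->
  is_principal_log
    (invmx P *m diag_mx (map_mx (fun x => (expR x)%:C) l) *m P)
    (invmx P *m diag_mx (map_mx (real_complex R) l) *m P).
Proof.
move=> Pu; split.
  apply: etrans (expm_conj _ Pu) _; congr (_ *m _ *m _); rewrite expm_diag.
  by congr diag_mx; apply/rowP => i; rewrite !mxE cexp_real.
move=> a /eigenvalueP[v]; rewrite !mulmxA => vX v0.
have /rV0Pn[i vi0] : v *m invmx P != 0.
  by apply: contraNneq v0 => vP; rewrite -[v](mulmxKV Pu) vP mul0mx.
have : v *m invmx P *m diag_mx (map_mx (real_complex R) l) = a *: (v *m invmx P).
  by rewrite scalemxAl -vX mulmxK.
move/matrixP/(_ 0 i); rewrite mul_mx_diag mxE [in RHS]mxE mulrC mxE.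
by move=> /(mulIf vi0) <-; rewrite /= oppr_lt0 pi_gt0.
Qed.

Lemma principal_log_diag_unique n (P X : 'M[C]_n.+1) (l : 'rV[R]_n.+1) :
  P \in unitmx ->
  is_principal_log
    (invmx P *m diag_mx (map_mx (fun x => (expR x)%:C) l) *m P) X ->
  X = invmx P *m diag_mx (map_mx (real_complex R) l) *m P.
Proof.
move=> Pu [XE Xpi].
have [V Vu] := diagonalizable_expm Pu XE.
have Vu' : invmx V \in unitmx by rewrite unitmx_inv.
move=> /(similar_diagLR Vu)[a]; rewrite (conjumx _ Vu') invmxK => Xa.
(* [W] is the change of basis between the eigenvectors of [X] and those of [expm X]; it intertwines
   the two diagonal forms of [expm X]. *)
have [W defW] : exists W, W = V *m invmx P by exists (V *m invmx P).
have WE : W *m diag_mx (map_mx (fun x => (expR x)%:C) l) =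
    diag_mx (map_mx (@cexp R) a) *m W.
  rewrite defW mulmxA -expm_diag.
  have -> : expm (diag_mx a) *m V = V *m expm X.
    by rewrite Xa (expm_conj _ Vu) !mulmxA mulmxV// mul1mx.
  by rewrite XE !mulmxA mulmxK.
have eigen i : - pi < Im (a 0 i) < pi.
  apply: Xpi; apply/eigenvalueP; exists (row i V).
    rewrite Xa -row_mul !mulmxA mulmxV// mul1mx.
    by rewrite row_mul row_diag_mx -scalemxAl -rowE.
  apply: contraTneq Vu => Vi0; rewrite unitmxE unitfE negbK.
  rewrite (expand_det_row _ i) big1// => j _.
  by move/rowP/(_ j): Vi0; rewrite !mxE => ->; rewrite mul0r.
(* Where [W i j] is nonzero, [cexp (a 0 i)] equals the exponential of [l 0 j], and the strip gives
   [a 0 i = l 0 j]: [W] intertwines the logarithms as well. *)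
have {}WE : W *m diag_mx (map_mx (real_complex R) l) = diag_mx a *m W.
  apply/matrixP => i j; move/matrixP/(_ i j): WE.
  rewrite !mul_mx_diag !mul_diag_mx !mxE => WE.
  have [->|W0] := eqVneq (W i j) 0; first by rewrite mul0r mulr0.
  rewrite mulrC; congr (_ * _); rewrite mulrC in WE; move/(mulIf W0): WE.
  by move/esym/(cexp_inj_ln (eigen i) (expR_gt0 _)); rewrite expRK.
rewrite Xa -[RHS](mulKmx Vu) -mulmxA; congr (_ *m _).
by rewrite !mulmxA -defW WE defW !mulmxA mulmxKV.
Qed.

End PrincipalLogarithm.

(** * Hermitian forms and growth of [expm X *m v] *)

Section HermitianForms.
Local Open Scope complex_scope.
Local Notation Re := (@complex.Re _).
Local Notation Im := (@complex.Im _).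
Variable R : realType.
Local Notation C := R[i].
Local Open Scope sesquilinear_scope.

Lemma adjmxM m n p (A : 'M[C]_(m, n)) (B : 'M[C]_(n, p)) :
  (A *m B)^t* = B^t* *m A^t*.
Proof. by rewrite trmx_mul map_mxM. Qed.

Lemma adj_diag_real n (s : 'rV[R]_n) :
  (diag_mx (map_mx (real_complex R) s))^t* = diag_mx (map_mx (real_complex R) s).
Proof.
rewrite tr_diag_mx map_diag_mx; congr diag_mx; apply/rowP => i.
by rewrite !mxE; exact: conjc_real.
Qed.

Lemma hermitian_spectral n (S : 'M[C]_n) : S^t* = S ->
  exists2 P : 'M[C]_n, P \is unitarymx &
  exists s : 'rV[R]_n, S = P^t* *m diag_mx (map_mx (real_complex R) s) *m P.
Proof.
move=> Sadj; have Sherm : S \is hermsymmx.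
  by apply/is_hermitianmxP; rewrite expr0 scale1r.
exists (spectralmx S); first exact: spectral_unitarymx.
exists (map_mx Re (spectral_diag S)).
rewrite -invmx_unitary ?spectral_unitarymx//.
suff -> : map_mx (real_complex R) (map_mx Re (spectral_diag S)) = spectral_diag S.
  exact/orthomx_spectralP/hermitian_normalmx.
apply/rowP => i; rewrite !mxE RRe_real//.
exact: (mxOverP (hermitian_spectral_diag_real Sherm)).
Qed.

Lemma unitary_adjK n (P : 'M[C]_n) : P \is unitarymx -> P^t* *m P = 1%:M.
Proof. by move=> /unitarymxP/mulmx1C. Qed.

Lemma adj_unitary n (P : 'M[C]_n) : P \is unitarymx -> P^t* \is unitarymx.
Proof. by move=> Pu; apply/unitarymxP; rewrite trmxCK unitary_adjK. Qed.

(** The squared Hermitian norm, written in real coordinates so that it is real-valued and can be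
    differentiated in a real parameter. *)
Definition sqn n (y : 'cV[C]_n) : R := \sum_i (Re (y i 0) ^+ 2 + Im (y i 0) ^+ 2).

Lemma sqnE n (y : 'cV[C]_n) : (sqn y)%:C = (y^t* *m y) 0 0.
Proof.
rewrite rmorph_sum mxE; apply: eq_bigr => i _; rewrite !mxE mulrC.
exact: etrans (add_Re2_Im2 _) (sqr_normc _).
Qed.

Lemma sqn_mulmx n (A : 'M[C]_n) (y : 'cV[C]_n) :
  (sqn (A *m y))%:C = (y^t* *m (A^t* *m A) *m y) 0 0.
Proof. by rewrite sqnE adjmxM !mulmxA. Qed.

Lemma sqn_unitary n (P : 'M[C]_n) (y : 'cV[C]_n) : P \is unitarymx ->
  sqn (P *m y) = sqn y.
Proof.
by move=> Pu; apply: complexI; rewrite sqn_mulmx (unitary_adjK Pu) mulmx1 sqnE.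
Qed.

Lemma quad_form_diag n (P : 'M[C]_n) (s : 'rV[R]_n) (y : 'cV[C]_n) :
  (y^t* *m (P^t* *m diag_mx (map_mx (real_complex R) s) *m P) *m y) 0 0 =
  (\sum_i s 0 i * (Re ((P *m y) i 0) ^+ 2 + Im ((P *m y) i 0) ^+ 2))%:C.
Proof.
rewrite !mulmxA -adjmxM -mulmxA; move: (P *m y) => z.
rewrite mul_mx_diag mxE rmorph_sum; apply: eq_bigr => i _.
rewrite [RHS](rmorphM (real_complex R)).
by rewrite [X in _ = _ * X](etrans (add_Re2_Im2 _) (sqr_normc _)) !mxE; ring.
Qed.

(** The adjoint of [X] has the conjugate quadratic form, so averaging the two leaves the real
    part. *)
Lemma Re_quad_form n (X : 'M[C]_n) (y : 'cV[C]_n) :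
  (Re ((y^t* *m X *m y) 0 0))%:C = (y^t* *m sym_star X *m y) 0 0.
Proof.
have adjE : (y^t* *m X^t* *m y) 0 0 = ((y^t* *m X *m y) 0 0)^*.
  have -> : y^t* *m X^t* *m y = (y^t* *m X *m y)^t*.
    by rewrite !adjmxM trmxCK mulmxA.
  by rewrite mxE mxE.
rewrite ReJ_add /sym_star -scalemxAr -scalemxAl [RHS]mxE mulmxDr mulmxDl.
rewrite [X in _ = _ * X]mxE adjE.
by rewrite addrC mulrC.
Qed.

Lemma frobenius_sqr n (X : 'M[C]_n) :
  (frobenius X ^+ 2)%:C = \tr (X^t* *m X).
Proof.
have normc_sqr (z : C) : (ComplexField.Normc.normc z ^+ 2)%:C = z^* * z.
  by rewrite rmorphXn mulrC -sqr_normc.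
rewrite /frobenius sqr_sqrtr; last first.
  by rewrite !sumr_ge0// => i _; rewrite sumr_ge0// => j _; rewrite sqr_ge0.
rewrite exchange_big rmorph_sum; apply: eq_bigr => i _; rewrite rmorph_sum mxE.
by apply: eq_bigr => j _; rewrite !mxE; exact: normc_sqr.
Qed.

Lemma frobenius_diag n (P : 'M[C]_n) (s : 'rV[R]_n) : P \is unitarymx ->
  frobenius (P^t* *m diag_mx (map_mx (real_complex R) s) *m P) ^+ 2 =
  \sum_i s 0 i ^+ 2.
Proof.
move=> Pu; apply: complexI; rewrite frobenius_sqr !adjmxM trmxCK adj_diag_real.
rewrite !mulmxA -(mulmxA _ P) (unitarymxP Pu) mulmx1 mxtrace_mulC !mulmxA.
rewrite (unitarymxP Pu) mul1mx mulmx_diag mxtrace_diag rmorph_sum.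
by apply: eq_bigr => i _; rewrite !mxE rmorphXn expr2.
Qed.

Lemma tr_sym_star n (X : 'M[C]_n) : \tr (sym_star X) = (Re (\tr X))%:C.
Proof.
rewrite ReJ_add /sym_star mxtraceZ raddfD /= mulrC addrC; congr ((_ + _) * _).
by rewrite rmorph_sum; apply: eq_bigr => i _; rewrite !mxE.
Qed.

Lemma tr_diag_unitary n (P : 'M[C]_n) (s : 'rV[R]_n) : P \is unitarymx ->
  \tr (P^t* *m diag_mx (map_mx (real_complex R) s) *m P) = (\sum_i s 0 i)%:C.
Proof.
move=> Pu; rewrite mxtrace_mulC mulmxA (unitarymxP Pu) mul1mx mxtrace_diag.
by rewrite rmorph_sum; apply: eq_bigr => i _; rewrite mxE.
Qed.

Lemma sym_star_adj n (X : 'M[C]_n) : (sym_star X)^t* = sym_star X.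
Proof.
apply/matrixP => i j; rewrite /sym_star !mxE rmorphM rmorphD /= conjCK.
by rewrite fmorphV rmorph_nat addrC.
Qed.

(** Gronwall's inequality: [expR (- k * t) * g t] has nonpositive derivative. *)
Lemma growth_le (g dg : R -> R) (k : R) :
  (forall t : R, is_derive t (1 : R) g (dg t)) -> (forall t, dg t <= k * g t) ->
  g 1 <= expR k * g 0.
Proof.
move=> dgP dgle; pose f t := expR (- k * t) * g t.
have df (t : R) : is_derive t (1 : R) f (expR (- k * t) * (dg t - k * g t)).
  rewrite /f; have dgt := dgP t.
  by apply: trigger_derive; rewrite /GRing.scale /=; ring.
have fd (t : R) : derivable f t 1 by have [] := df t.
have : f 1 <= f 0.
  apply: (@ler0_derive1_nincr _ _ 0 1) => //.
  - move=> x _; rewrite derive1E (@derive_val _ _ _ _ _ _ _ (df x)).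
    rewrite mulr_ge0_le0 ?expR_ge0//.
    by rewrite subr_le0.
  - apply: continuous_subspaceT => x; apply: differentiable_continuous.
    by apply/derivable1_diffP; exact: fd.
rewrite /f mulr1 mulr0 expR0 mul1r expRN => /(ler_wpM2l (expR_ge0 k)).
by rewrite mulrA mulfV ?mul1r// gt_eqF ?expR_gt0.
Qed.

Lemma is_derive_sum_sqr (u w : R -> R) (t du dw : R) :
  is_derive t (1 : R) u du -> is_derive t (1 : R) w dw ->
  is_derive t (1 : R) (fun s => u s ^+ 2 + w s ^+ 2) (2 * (u t * du + w t * dw)).
Proof.
by move=> u' w'; apply: trigger_derive; rewrite /GRing.scale /=; ring.
Qed.

(** The curve is [y(t) = exp(tX) v], given by the generating functions of its coordinates; shifting
    these is multiplication by [X], whence [y' = X y]. *)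
Lemma is_derive_sqn_expm n (X : 'M[C]_n) (v : 'cV[C]_n) :
  exists2 y : R -> 'cV[C]_n, y 0 = v /\ y 1 = expm X *m v &
  forall t : R, is_derive t (1 : R) (fun t => sqn (y t))
    (2 * Re (((y t)^t* *m X *m y t) 0 0)).
Proof.
pose c i k := (X ^+ k *m v) i 0.
have cb i : exp_bounded (c i).
  have := exp_bounded_mulmx 1%:M X v i 0.
  by congr exp_bounded; apply/funext => k; rewrite mul1mx.
pose y t : 'cV[C]_n := \col_i egfc (c i) t.
exists y.
  split; apply/colP => i; rewrite [LHS]mxE.
    by rewrite egfc_at0 /c expr0 mul1mx.
  transitivity ((1%:M *m expm X *m v) i 0); last by rewrite mul1mx.
  rewrite mulmx_expmE; apply: (congr1 (fun a => egfc a 1)); apply/funext => k.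
  by rewrite mul1mx.
move=> t; have yE i s : y s i 0 = egfc (c i) s by rewrite mxE.
have shiftE i : egfc (fun k => c i k.+1) t = (X *m y t) i 0.
  rewrite mxE; under [RHS]eq_bigr do rewrite yE.
  rewrite -egfc_sum//; apply: (congr1 (fun a => egfc a t)); apply/funext => k.
  by rewrite /c exprS -mulmxE -mulmxA mxE.
rewrite (_ : (fun t => _) = \sum_i (fun s : R =>
    Re (egfc (c i) s) ^+ 2 + Im (egfc (c i) s) ^+ 2)); last first.
  apply/funext => s; rewrite fct_sumE; apply: eq_bigr => i _.
  by rewrite yE.
apply: (@is_derive_eq _ _ _ _ _ _ _ (\sum_i (2 * (Re (y t i 0) * Re ((X *m y t) i 0)
    + Im (y t i 0) * Im ((X *m y t) i 0))))).
  apply: is_derive_sum => i; have [dRe dIm] := is_derive_egfc t (cb i).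
  by rewrite -shiftE yE; exact: is_derive_sum_sqr dRe dIm.
rewrite -mulr_sumr -mulmxA [in RHS]mxE raddf_sum; congr (_ * _).
apply: eq_bigr => i _ /=; move: (X *m y t) => z; rewrite !mxE.
move: (egfc _ t) (z i 0) => w {}z; transitivity (Re (conjc w * z)) => //.
by case: w z => [? ?] [? ?] /=; ring.
Qed.

Lemma sqn_expm_le n (X : 'M[C]_n) (v : 'cV[C]_n) (M : R) :
  (forall y : 'cV[C]_n, Re ((y^t* *m X *m y) 0 0) <= M * sqn y) ->
  sqn (expm X *m v) <= expR (2 * M) * sqn v.
Proof.
move=> XM; have [y [y0 y1] dy] := is_derive_sqn_expm X v.
rewrite -y1 -y0; apply: growth_le dy _ => t.
by rewrite -mulrA ler_pM2l.
Qed.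

Lemma sqn_expm_ge n (X : 'M[C]_n) (v : 'cV[C]_n) (m : R) :
  (forall y : 'cV[C]_n, m * sqn y <= Re ((y^t* *m X *m y) 0 0)) ->
  expR (2 * m) * sqn v <= sqn (expm X *m v).
Proof.
move=> Xm; have [y [y0 y1] dy] := is_derive_sqn_expm X v.
(* The lower bound is [growth_le] for the negative of the squared norm. *)
have dyN (t : R) := is_deriveN (dy t).
rewrite -lerN2 -mulrN -y1 -y0; apply: (growth_le dyN) => t.
by rewrite mulrN lerN2 -mulrA ler_pM2l.
Qed.

End HermitianForms.

(** * Singular values of a matrix exponential *)

Section SingularValues.
Local Open Scope complex_scope.
Local Notation Re := (@complex.Re _).
Local Notation Im := (@complex.Im _).
Variable R : realType.
Local Notation C := R[i].
Local Open Scope sesquilinear_scope.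

(** For [w = x + i y] and real [H], the cross terms of the form are purely imaginary, and one of
    [x], [y] is nonzero. *)
Lemma posdef_cplx n (H : 'M[R]_n) (w : 'cV[C]_n) : posdef_sym H -> w != 0 ->
  0 < Re ((w^t* *m cplx_mx H *m w) 0 0).
Proof.
move=> [_ Hpos] w0; pose x := map_mx Re w; pose y := map_mx Im w.
have -> : Re ((w^t* *m cplx_mx H *m w) 0 0) =
    (x^T *m H *m x) 0 0 + (y^T *m H *m y) 0 0.
  rewrite !mxE raddf_sum -big_split; apply: eq_bigr => j _ /=.
  rewrite !mxE !mulr_suml raddf_sum -big_split; apply: eq_bigr => i _ /=.
  rewrite !mxE; transitivity (Re (conjc (w i 0) * (H i j)%:C * w j 0)) => //.
  by case: (w i 0) (w j 0) => [? ?] [? ?] /=; ring.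
have pos0 (v : 'cV[R]_n) : 0 <= (v^T *m H *m v) 0 0.
  have [->|/Hpos/ltW//] := eqVneq v 0; by rewrite mulmx0 mxE.
have [x0|/Hpos xpos] := eqVneq x 0; last by rewrite ltr_wpDr.
have [y0|/Hpos ypos] := eqVneq y 0; last by rewrite ltr_wpDl.
case/negP: w0; apply/eqP/colP => i.
move/colP/(_ i): x0; move/colP/(_ i): y0; rewrite !mxE.
by case: (w i 0) => ? ? /= -> ->.
Qed.

(** A positive diagonal is parametrized by the logarithms of its entries, so that [l] holds the
    eigenvalues of the matrix logarithm. *)
Definition expR_diag n (l : 'rV[R]_n) : 'M[C]_n :=
  diag_mx (map_mx (fun x => (expR x)%:C) l).

Lemma sqn_delta n (i : 'I_n) : sqn (delta_mx i 0 : 'cV[C]_n) = 1.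
Proof.
rewrite /sqn (bigD1 i)//= big1 ?addr0 => [|j ji].
  by rewrite !mxE !eqxx /= expr1n expr0n addr0.
by rewrite !mxE (negbTE ji) /= expr0n addr0.
Qed.

Lemma sqn_expR_diag n (l : 'rV[R]_n) i :
  sqn (expR_diag l *m delta_mx i 0) = expR (2 * l 0 i).
Proof.
have -> : expR_diag l *m delta_mx i 0 =
    (expR (l 0 i))%:C *: (delta_mx i 0 : 'cV[C]_n).
  apply/colP => j; rewrite mul_diag_mx !mxE.
  by case: (eqVneq j i) => [->//|_]; rewrite !mulr0.
rewrite mulrC expRM_natr -[RHS]mulr1 -(sqn_delta i) /sqn mulr_sumr.
apply: eq_bigr => j _; rewrite mxE; case: (delta_mx _ _ _ _) => a b /=; ring.
Qed.

Lemma posdef_spectral n (H : 'M[R]_n) : posdef_sym H ->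
  exists2 P : 'M[C]_n, P \is unitarymx &
  exists l : 'rV[R]_n, cplx_mx H = P^t* *m expR_diag l *m P.
Proof.
move=> Hpos; have Hadj : (cplx_mx H)^t* = cplx_mx H.
  apply/matrixP => i j; rewrite !mxE -[in RHS](proj1 Hpos) mxE.
  exact: conjc_real.
have [P Pu [s HE]] := hermitian_spectral Hadj.
have s_gt0 i : 0 < s 0 i.
  (* An eigenvector for [s 0 i], at which the quadratic form takes the value [s 0 i]. *)
  pose w : 'cV[C]_n := P^t* *m delta_mx i 0.
  have Pw : P *m w = delta_mx i 0 by rewrite mulmxA (unitarymxP Pu) mul1mx.
  have w0 : w != 0.
    apply/eqP => w0; move: (sqn_delta i); rewrite -Pw w0 mulmx0 /sqn big1.
      by move/esym/eqP; rewrite oner_eq0.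
    by move=> j _; rewrite mxE /= expr0n addr0.
  have := posdef_cplx Hpos w0; rewrite HE quad_form_diag Pw /=.
  rewrite (bigD1 i)//= big1 ?addr0 => [|j ji].
    by rewrite !mxE !eqxx /= expr1n expr0n addr0 mulr1.
  by rewrite !mxE (negbTE ji) /= expr0n addr0 mulr0.
exists P => //; exists (map_mx (@ln R) s); rewrite HE /expR_diag.
suff -> : map_mx (fun x => (expR x)%:C) (map_mx (@ln R) s) =
  map_mx (real_complex R) s by [].
by apply/rowP => i; rewrite !mxE lnK// posrE.
Qed.

(** Quantifying over all upper bounds [M] and lower bounds [m] of [s] expresses its maximum and
    minimum without selecting an index. *)
Lemma log_singular_values_le n (X P Q M0 : 'M[C]_n) (l s : 'rV[R]_n) :
  P \is unitarymx -> Q \is unitarymx ->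
  M0 = P^t* *m expR_diag l *m P -> (expm X)^t* *m expm X = M0 *m M0 ->
  sym_star X = Q^t* *m diag_mx (map_mx (real_complex R) s) *m Q ->
  [/\ forall M, (forall i, s 0 i <= M) -> forall i, l 0 i <= M,
      forall m, (forall i, m <= s 0 i) -> forall i, m <= l 0 i &
      \sum_i l 0 i = \sum_i s 0 i].
Proof.
move=> Pu Qu M0E EE SE; have Pu' := adj_unitary Pu.
have M0adj : M0^t* = M0.
  rewrite M0E !adjmxM trmxCK !mulmxA.
  suff -> : (expR_diag l)^t* = expR_diag l by [].
  rewrite /expR_diag (_ : map_mx _ l = map_mx (real_complex R) (map_mx expR l)).
    exact: adj_diag_real.
  by apply/rowP => i; rewrite !mxE.
(* A unit eigenvector of [M0], whose squared norm [expm X] multiplies by [expR (2 * l 0 i)]. *)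
pose w i : 'cV[C]_n := P^t* *m delta_mx i 0.
have sqn_w i : sqn (w i) = 1 by rewrite (sqn_unitary _ Pu') sqn_delta.
have sqn_Ew i : sqn (expm X *m w i) = expR (2 * l 0 i).
  have -> : sqn (expm X *m w i) = sqn (M0 *m w i).
    by apply: complexI; rewrite !sqn_mulmx M0adj EE.
  have -> : M0 *m w i = P^t* *m (expR_diag l *m delta_mx i 0).
    by rewrite M0E /w -!mulmxA (mulmxA P) (unitarymxP Pu) mul1mx.
  by rewrite (sqn_unitary _ Pu') sqn_expR_diag.
have formE (y : 'cV[C]_n) : Re ((y^t* *m X *m y) 0 0) =
    \sum_i s 0 i * (Re ((Q *m y) i 0) ^+ 2 + Im ((Q *m y) i 0) ^+ 2).
  by have := Re_quad_form X y; rewrite SE quad_form_diag => /(@complexI R).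
split.
- move=> M sM i.
  have := @sqn_expm_le _ _ X (w i) M; rewrite sqn_Ew sqn_w mulr1 ler_expR.
  rewrite ler_pM2l//; apply=> y; rewrite formE -(sqn_unitary y Qu) mulr_sumr.
  by apply: ler_sum => j _; rewrite ler_wpM2r// addr_ge0 ?sqr_ge0.
- move=> m ms i.
  have := @sqn_expm_ge _ _ X (w i) m; rewrite sqn_Ew sqn_w mulr1 ler_expR.
  rewrite ler_pM2l//; apply=> y; rewrite formE -(sqn_unitary y Qu) mulr_sumr.
  by apply: ler_sum => j _; rewrite ler_wpM2r// addr_ge0 ?sqr_ge0.
- apply: expR_inj; apply: complexI.
  have detM0 : \det M0 = (expR (\sum_i l 0 i))%:C.
    rewrite M0E !det_mulmx mulrAC -det_mulmx (unitary_adjK Pu) det1 mul1r.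
    rewrite det_diag expR_sum rmorph_prod; apply: eq_bigr => i _.
    by rewrite mxE.
  have -> : \sum_i s 0 i = Re (\tr X).
    by apply: complexI; rewrite -tr_sym_star SE tr_diag_unitary.
  (* The modulus of [\det (expm X)] and [\det M0] are both nonnegative, so comparing squares
     suffices; these are the determinants of the two sides of [EE]. *)
  rewrite -normc_det_expm -detM0; apply/eqP.
  rewrite -(@eqrXn2 _ 2)//; last by rewrite detM0 lecR expR_ge0.
  rewrite sqr_normc mulrC expr2 -det_mulmx -EE det_mulmx.
  by rewrite det_map_mx det_tr.
Qed.

(** * Sums of squares under majorization in dimensions 2 and 3 *)

Lemma sum_sqr2_le (a b x y : R) : a <= b -> a <= x <= b -> a <= y <= b ->
  x + y = a + b -> x ^+ 2 + y ^+ 2 <= a ^+ 2 + b ^+ 2.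
Proof. by move=> ab /andP[ax xb] /andP[ay yb] xy; nra. Qed.

(* Abel summation of [2 (x (a - x) + y (b - y) + z (c - z))]. *)
Lemma sum_sqr3_sorted (a b c x y z : R) : x <= y -> y <= z -> a <= x -> z <= c ->
  x + y + z = a + b + c -> x ^+ 2 + y ^+ 2 + z ^+ 2 <= a ^+ 2 + b ^+ 2 + c ^+ 2.
Proof.
move=> xy yz ax zc sumE.
have h1 : 0 <= (y - x) * (x - a) by rewrite mulr_ge0 ?subr_ge0.
have h2 : 0 <= (z - y) * (c - z) by rewrite mulr_ge0 ?subr_ge0.
have bE : b = x + y + z - a - c by rewrite sumE; ring.
have h3 : 0 <= (a - x) ^+ 2 + (b - y) ^+ 2 + (c - z) ^+ 2.
  by rewrite !addr_ge0 ?sqr_ge0.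
rewrite -subr_ge0 (_ : _ - _ = (a - x) ^+ 2 + (b - y) ^+ 2 + (c - z) ^+ 2
  + 2 * ((y - x) * (x - a) + (z - y) * (c - z))); last by rewrite bE; ring.
by rewrite addr_ge0// mulr_ge0// addr_ge0.
Qed.

Lemma sum_sqr3_le (a b c x y z : R) :
  a <= x <= c -> a <= y <= c -> a <= z <= c ->
  x + y + z = a + b + c -> x ^+ 2 + y ^+ 2 + z ^+ 2 <= a ^+ 2 + b ^+ 2 + c ^+ 2.
Proof.
move=> /andP[ax xc] /andP[ay yc] /andP[az zc] sumE.
have sorted (u v w : R) : u <= v -> v <= w -> a <= u -> w <= c ->
    u + v + w = x + y + z -> u ^+ 2 + v ^+ 2 + w ^+ 2 = x ^+ 2 + y ^+ 2 + z ^+ 2 ->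
    x ^+ 2 + y ^+ 2 + z ^+ 2 <= a ^+ 2 + b ^+ 2 + c ^+ 2.
  by move=> uv vw au wc uvw <-; apply: sum_sqr3_sorted; rewrite ?uvw.
(* Two of the eight outcomes are contradictory; they are closed like the others, by the order that
   the first two comparisons give. *)
have [xy|yx] := leP x y; have [yz|zy] := leP y z; have [xz|zx] := leP x z.
- by apply: (sorted x y z) => //; ring.
- by apply: (sorted x y z) => //; ring.
- by apply: (sorted x z y) => //; first exact: ltW; ring.
- by apply: (sorted z x y) => //; first exact: ltW; ring.
- by apply: (sorted y x z) => //; first exact: ltW; ring.
- by apply: (sorted y z x) => //; first exact: ltW; ring.
- by apply: (sorted z y x) => //; [exact: ltW|exact: ltW|ring|ring].
- by apply: (sorted z y x) => //; [exact: ltW|exact: ltW|ring|ring].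
Qed.

(** Majorization bounds the sums of the [k] largest entries. For three entries the sum of the two
    largest is the total minus the smallest, so maximum, minimum and total carry the whole
    condition. *)
Lemma sum_sqr_le n (l s : 'rV[R]_n) : (n = 2 \/ n = 3)%N ->
  (forall M, (forall i, s 0 i <= M) -> forall i, l 0 i <= M) ->
  (forall m, (forall i, m <= s 0 i) -> forall i, m <= l 0 i) ->
  \sum_i l 0 i = \sum_i s 0 i ->
  \sum_i l 0 i ^+ 2 <= \sum_i s 0 i ^+ 2.
Proof.
move=> [n2|n3]; subst n => hM hm.
- rewrite !big_ord_recl !big_ord0 !addr0.
  set i0 := ord0; set i1 := lift ord0 ord0 => lsum.
  have cover (Q : R -> Prop) : Q (s 0 i0) -> Q (s 0 i1) -> forall i, Q (s 0 i).
    move=> Q0 Q1 i; case: (unliftP ord0 i) => [j ->|->//].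
    by rewrite (ord1 j).
  have [s01|/ltW s10] := leP (s 0 i0) (s 0 i1).
  - have hi := hM _ (cover (fun t => t <= s 0 i1) s01 (lexx _)).
    have lo := hm _ (cover (fun t => s 0 i0 <= t) (lexx _) s01).
    by apply: sum_sqr2_le => //; rewrite ?hi ?lo.
  - have hi := hM _ (cover (fun t => t <= s 0 i0) (lexx _) s10).
    have lo := hm _ (cover (fun t => s 0 i1 <= t) s10 (lexx _)).
    rewrite [leRHS]addrC; apply: sum_sqr2_le; rewrite ?hi ?lo//.
    by rewrite [RHS]addrC.
- rewrite !big_ord_recl !big_ord0 !addr0 !addrA.
  set i0 : 'I_3 := ord0; set i1 : 'I_3 := lift ord0 ord0.
  set i2 : 'I_3 := lift ord0 (lift ord0 ord0) => lsum.
  have cover (Q : R -> Prop) :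
      Q (s 0 i0) -> Q (s 0 i1) -> Q (s 0 i2) -> forall i, Q (s 0 i).
    move=> Q0 Q1 Q2 i; case: (unliftP ord0 i) => [j ->|->//].
    case: (unliftP ord0 j) => [k ->|->//].
    by rewrite (ord1 k).
  (* [u], [v], [w] stand for the entries of [s] in increasing order. *)
  have key (u v w : R) : u <= v -> v <= w ->
      u + v + w = s 0 i0 + s 0 i1 + s 0 i2 ->
      u ^+ 2 + v ^+ 2 + w ^+ 2 = s 0 i0 ^+ 2 + s 0 i1 ^+ 2 + s 0 i2 ^+ 2 ->
      [&& u <= s 0 i0 <= w, u <= s 0 i1 <= w & u <= s 0 i2 <= w] ->
      l 0 i0 ^+ 2 + l 0 i1 ^+ 2 + l 0 i2 ^+ 2 <=
      s 0 i0 ^+ 2 + s 0 i1 ^+ 2 + s 0 i2 ^+ 2.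
    move=> uv vw uvw <- /and3P[b0 b1 b2].
    have bnd := cover (fun t => is_true (u <= t <= w)) b0 b1 b2.
    have hi : forall i, l 0 i <= w by apply: hM => i; case/andP: (bnd i).
    have lo : forall i, u <= l 0 i by apply: hm => i; case/andP: (bnd i).
    by apply: sum_sqr3_le; rewrite ?hi ?lo ?uvw.
  have [s01|s10] := leP (s 0 i0) (s 0 i1);
    have [s12|s21] := leP (s 0 i1) (s 0 i2);
    have [s02|s20] := leP (s 0 i0) (s 0 i2).
  + by apply: (key (s 0 i0) (s 0 i1) (s 0 i2)); try lra; ring.
  + by apply: (key (s 0 i0) (s 0 i1) (s 0 i2)); try lra; ring.
  + by apply: (key (s 0 i0) (s 0 i2) (s 0 i1)); try lra; ring.
  + by apply: (key (s 0 i2) (s 0 i0) (s 0 i1)); try lra; ring.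
  + by apply: (key (s 0 i1) (s 0 i0) (s 0 i2)); try lra; ring.
  + by apply: (key (s 0 i1) (s 0 i2) (s 0 i0)); try lra; ring.
  + by apply: (key (s 0 i2) (s 0 i1) (s 0 i0)); try lra; ring.
  + by apply: (key (s 0 i2) (s 0 i1) (s 0 i0)); try lra; ring.
Qed.

End SingularValues.

(** * The optimality of the polar factor *)

Section Objective.
Local Open Scope complex_scope.
Local Notation Re := (@complex.Re _).
Local Notation Im := (@complex.Im _).
Variable R : realType.
Local Notation C := R[i].
Local Open Scope sesquilinear_scope.

Lemma cplx_mx_adj n (A : 'M[R]_n) : (cplx_mx A)^t* = cplx_mx A^T.
Proof. by apply/matrixP => i j; rewrite !mxE; exact: conjc_real. Qed.

Lemma skew_star_hermitian n (X : 'M[C]_n) : X^t* = X -> skew_star X = 0.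
Proof. by rewrite /skew_star => ->; rewrite subrr scaler0. Qed.

Lemma sym_star_hermitian n (X : 'M[C]_n) : X^t* = X -> sym_star X = X.
Proof.
move=> XE; rewrite /sym_star XE; apply/matrixP => i j; rewrite !mxE.
by rewrite -mulr2n -[X in _ * X]mulr_natl mulKf// pnatr_eq0.
Qed.

Lemma frobenius0 n : frobenius (0 : 'M[C]_n) = 0.
Proof.
rewrite /frobenius big1 ?sqrtr0// => i _; rewrite big1// => j _.
by rewrite mxE ComplexField.Normc.normc0 expr0n.
Qed.

(** [logm] is a choice: existence of a principal logarithm makes the chosen value one, and
    uniqueness identifies it. *)
Lemma logm_posdef n (P M : 'M[C]_n.+1) (l : 'rV[R]_n.+1) : P \is unitarymx ->
  M = P^t* *m expR_diag l *m P ->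
  is_principal_log M (logm M) /\
  logm M = P^t* *m diag_mx (map_mx (real_complex R) l) *m P.
Proof.
move=> Pu ->; have Pun := unitarymx_unit Pu.
rewrite -(invmx_unitary Pu) /expR_diag.
have plog := is_principal_log_diag l Pun.
have Lplog := xgetI 0 plog; split; first exact: Lplog.
exact: principal_log_diag_unique Pun Lplog.
Qed.

Lemma sum_sqr_log_le n (X P M : 'M[C]_n) (l : 'rV[R]_n) : (n = 2 \/ n = 3)%N ->
  P \is unitarymx -> M = P^t* *m expR_diag l *m P ->
  (expm X)^t* *m expm X = M *m M ->
  \sum_i l 0 i ^+ 2 <= frobenius (sym_star X) ^+ 2.
Proof.
move=> hn Pu ME EE; have [Q Qu [s SE]] := hermitian_spectral (sym_star_adj X).
have [hM hm lsum] := log_singular_values_le Pu Qu ME EE SE.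
by rewrite SE (frobenius_diag _ Qu); exact: sum_sqr_le.
Qed.

End Objective.

Theorem mainTheorem2 (R : realType) (n : nat) (hn : n = 2%N \/ n = 3%N)
    (Z Up H : 'M[R]_n) (mu muc : R)
    (hZ : GLp Z) (hUp : SO Up) (hH : posdef_sym H) (hpolar : Z = Up *m H)
    (hmu : 0 < mu) (hmuc : 0 <= muc) :
  let L := logm (cplx_mx (Up^T *m Z)) in
  [/\ is_principal_log (cplx_mx (Up^T *m Z)) L,
      is_minimizer (fun p : 'M[R]_n * 'M[R[i]]_n => log_objective mu muc p.2)
        (log_candidates Z) (Up, L),
      is_minimum
        [set log_objective mu muc p.2 | p in log_candidates Z]
        (mu * frobenius (sym_star L) ^+ 2 + muc * frobenius (skew_star L) ^+ 2)
    & mu * frobenius (sym_star L) ^+ 2 + muc * frobenius (skew_star L) ^+ 2 =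
      mu * frobenius (sym_star L) ^+ 2].
Proof.
(* Size 0 is excluded by [hn]; the results on [logm] are stated in size [n'.+1]. *)
move=> L; case: n hn Z Up H hZ hUp hH hpolar @L => [[]//|n'] {}hn {}Z {}Up {}H.
move=> _ [UpU detUp] hH hpolar L.
have UpZ : Up^T *m Z = H by rewrite hpolar mulmxA UpU mul1mx.
have [P Pu [l HE]] := posdef_spectral hH.
rewrite -UpZ in HE; have [plog LE] := logm_posdef Pu HE.
rewrite -/L in plog LE; clearbody L.
have Ladj : (L^t*)%sesqui = L.
  by rewrite LE !adjmxM trmxCK adj_diag_real !mulmxA.
have symL : frobenius (sym_star L) ^+ 2 = \sum_i l 0 i ^+ 2.
  by rewrite (sym_star_hermitian Ladj) LE (frobenius_diag _ Pu).
have skewL : muc * frobenius (skew_star L) ^+ 2 = 0.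
  by rewrite (skew_star_hermitian Ladj) frobenius0 expr0n mulr0.
have objL : log_objective mu muc L = mu * \sum_i l 0 i ^+ 2.
  by rewrite /log_objective [X in _ + X]skewL addr0 [X in _ * X]symL.
have cand : log_candidates Z (Up, L).
  exact: (conj (conj UpU detUp) (proj1 plog)).
have min (p : 'M[R]_n'.+1 * 'M[R[i]]_n'.+1) : log_candidates Z p ->
    log_objective mu muc L <= log_objective mu muc p.2.
  case: p => Q X [[/= QU detQ] XE].
  (* The two parts are compared separately, the skew part of [X] against 0. *)
  rewrite objL /log_objective -[leLHS]addr0; apply: lerD; last first.
    by rewrite mulr_ge0// sqr_ge0.
  rewrite (ler_pM2l hmu).
  apply: (sum_sqr_log_le hn Pu HE).
  (* The rotation cancels: the Gram matrix of [Q^T *m Z] is that of [Z], which is the square of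
     [H]. *)
  rewrite XE cplx_mx_adj -!map_mxM UpZ; congr map_mx.
  rewrite trmx_mul trmxK -mulmxA (mulmxA Q) (mulmx1C QU) mul1mx hpolar.
  by rewrite trmx_mul -mulmxA (mulmxA Up^T) UpU mul1mx (proj1 hH).
split=> //.
- by split; [exists (Up, L)|move=> _ [p pc <-]; exact: min].
- by rewrite [X in _ + X]skewL addr0.
Qed.
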